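(* Let $G$ be a finite group of odd order $n$. If $\psi(G) > \frac{271}{3647}\,\psi(C_n)$, then $G$ is supersolvable.
   Context: All groups are finite. For a finite group $G$, $\psi(G)=\sum_{g\in G} o(g)$, where $o(g)$ is the order of $g$. $C_n$ denotes the cyclic group of order $n$. *)

(* Defs.v *)
From mathcomp Require Import all_boot all_order all_fingroup all_solvable.
Set Implicit Arguments. Unset Strict Implicit. Unset Printing Implicit Defensive.
Open Scope group_scope.

Definition psi (gT : finGroupType) (G : {set gT}) : nat :=
  (\sum_(g in G) #[g])%N.

(* psi(C_n): the element of C_n = Z/nZ represented by i (0 <= i < n)
   has order n / gcd(i, n). *)
Definition psi_cyclic (n : nat) : nat :=
  (\sum_(i < n) n %/ gcdn i n)%N.

Definition supersolvable (gT : finGroupType) (G : {group gT}) : Prop :=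
  exists s : seq {group gT},
    [/\ head 1%G s = 1%G :> {set gT},
        last 1%G s = G :> {set gT},
        all (fun H : {group gT} => H <| G) s &
        path (fun H K : {group gT} => (H \subset K) && cyclic (K / H)) 1%G s].

(* Main.v *)
Require Import Defs.
From Stdlib Require Import NArith.
From mathcomp Require Import all_boot all_order all_fingroup all_solvable.
From mathcomp Require Import ssralg zify ring.
Set Implicit Arguments. Unset Strict Implicit. Unset Printing Implicit Defensive.
Local Open Scope group_scope.

(** Induction on [|G|].  If [G] has a nontrivial normal cyclic Sylow subgroup
    [R], then [psi G <= psi R * psi (G / R)] lets the hypothesis descend to
    [G / R].  Otherwise let [A] be generated by an element of maximal order and
    [m = |G : A|]; the hypothesis and [psi (C_n) >= n^2 \prod_(r | n) r / (r + 1)]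
    give [m < 3647 / 271 * \prod_(r | n) (1 + 1 / r)].  A prime [r] dividing [n]
    but not [m] has a cyclic Sylow subgroup inside [A], so the number of Sylow
    [r]-subgroups is a divisor [d != 1] of [m] with [d = 1] modulo [r].  Hence the
    primes dividing [n] are controlled by [m], and a finite computation leaves:
    [G] cyclic, [m] prime (where [A :&: A :^ g] is central, whence [G] is
    supersolvable), [G] a 3-group, [m = 21] or [m = 15].  For the last two,
    Burnside's transfer argument leaves only [m = 15] and [n = 3^a 5^b].  There
    the Sylow 5-subgroup is normal, and [G] is supersolvable unless it is
    elementary abelian of order 25 with an action of order 3 without fixed
    points outside the kernel; then
    [psi G <= 96 psi (C_(3^(a-1))) + 25 psi (C_(3^a))],
    which violates the hypothesis (with equality for [C_5^2 : C_3]). *)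

(** * Supersolvable series *)

(** Letting the series start at any [N] allows it to be assembled downwards from [G], one factor at
    a time, and to be lifted from a quotient. *)
Definition supersolvable_over (gT : finGroupType) (N G : {group gT}) : Prop :=
  exists s : seq {group gT},
    [/\ last N s = G :> {set gT},
        all (fun H : {group gT} => H <| G) s &
        path (fun H K : {group gT} => (H \subset K) && cyclic (K / H)) N s].

Section SupersolvableOver.
Variable gT : finGroupType.
Implicit Types G N M : {group gT}.

Lemma supersolvable_over_refl G : supersolvable_over G G.
Proof. by exists [::]. Qed.

Lemma supersolvable_over_cons N M G :
    N \subset M -> M <| G -> cyclic (M / N) -> supersolvable_over M G ->
  supersolvable_over N G.
Proof.
move=> sNM nMG cMN [s [sl sa sp]]; exists (M :: s).
by rewrite /= nMG sNM cMN.
Qed.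

Lemma supersolvable_overP G : supersolvable_over 1%G G -> supersolvable G.
Proof.
(* The list gets [1] in front so that [head] is an actual entry; the additional first factor is
   [1 / 1]. *)
case=> s [sl sa sp]; exists (1%G :: s).
by rewrite /= sl normal1 sa subxx quotientS1 ?cyclic1 ?sub1G.
Qed.

(** A series of [G / N] is pulled back along [coset N]; by the third isomorphism theorem its factors
    do not change. *)
Lemma supersolvable_over_quotient N G :
  N <| G -> supersolvable (G / N)%G -> supersolvable_over N G.
Proof.
move=> nNG [s [_ sl sa sp]].
pose f (K : {group coset_of N}) := (coset N @*^-1 K)%G.
pose U : {group coset_of N} := 1%G.
have f1 : f U = N by apply/val_inj; rewrite /= -kerE ker_coset.
have fG : f (G / N)%G = G by apply/val_inj/quotientGK.
have fn (K : {group coset_of N}) : K <| (G / N)%G -> f K <| G.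
  by rewrite -{2}fG cosetpre_normal.
have : [/\ last (f U) (map f s) = G, all (fun H : {group gT} => H <| G) (map f s) &
   path (fun H K : {group gT} => (H \subset K) && cyclic (K / H)) (f U) (map f s)].
  rewrite last_map; split.
  - by rewrite -fG; congr f; apply/val_inj.
  - by rewrite all_map; apply: sub_all sa => K /fn.
  have: U <| (G / N)%G by apply: normal1.
  rewrite -/U in sp; elim: s (U) sa sp {sl} => //= K s IHs L /andP[nK sa] /andP[/andP[sLK cKL] sp] nL.
  rewrite (IHs K) // cosetpreSK sLK /= andbT.   have nfLK : f L <| f K.
    by rewrite cosetpre_normal (normalS sLK _ nL) ?(normal_sub nK).
  have nNK : N <| f K by rewrite normal_cosetpre.
  have sNL : N \subset f L by rewrite sub_cosetpre.
  have := isog_cyclic (third_isog sNL nNK nfLK). rewrite cosetpreK => <-; rewrite /= cosetpreK; exact: cKL.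
by rewrite f1 => -[sl' sa' sp']; exists (map f s); rewrite sl'.
Qed.


Lemma supersolvable_quotient N G :
  N <| G -> cyclic N -> supersolvable (G / N)%G -> supersolvable G.
Proof.
move=> nNG cN ssGN; apply/supersolvable_overP/(@supersolvable_over_cons _ N).
- exact: sub1G.
- exact: nNG.
- by rewrite quotient_cyclic.
exact: supersolvable_over_quotient.
Qed.

End SupersolvableOver.

Lemma cyclic_supersolvable (gT : finGroupType) (G : {group gT}) :
  cyclic G -> supersolvable G.
Proof.
move=> cG; apply/supersolvable_overP.
apply: (supersolvable_over_cons (sub1G G)) (supersolvable_over_refl G) => //.
by rewrite quotient_cyclic.
Qed.

(** Induction on the order, dividing by the cyclic group generated by a nontrivial central
    element. *)
Lemma pgroup_supersolvable (p : nat) (gT : finGroupType) (G : {group gT}) :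
  p.-group G -> supersolvable G.
Proof.
have [n] := ubnP #|G|; elim: n gT G => // n IHn gT G leGn pG.
have [G1 | ntG] := eqVneq (G : {set gT}) 1.
  by apply: cyclic_supersolvable; rewrite G1 cyclic1.
have /trivgPn[z Zz ntz] : 'Z(G) != 1.
  by apply: contraNneq ntG => /(trivg_center_pgroup pG) ->.
have nzG : <[z]> <| G by apply: sub_center_normal; rewrite cycle_subG.
apply: (supersolvable_quotient nzG (cycle_cyclic z)).
apply: IHn; last exact: quotient_pgroup.
rewrite ltnS in leGn; apply: leq_trans leGn; rewrite ltn_quotient ?cycle_eq1 //.
exact: normal_sub.
Qed.

Lemma pgroup_quotient_supersolvable_over (p : nat) (gT : finGroupType)
     (N G : {group gT}) :
  N <| G -> p.-group (G / N) -> supersolvable_over N G.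
Proof.
by move=> nNG /pgroup_supersolvable/(supersolvable_over_quotient nNG).
Qed.

(** * Sums of element orders *)

Lemma psi_cycle (gT : finGroupType) (x : gT) : psi <[x]> = psi_cyclic #[x].
Proof.
have -> : <[x]> = [set x ^+ (i : 'I_#[x]) | i in 'I_#[x]].
  apply/setP=> y; apply/idP/imsetP=> [/cyclePmin[i lti ->] | [i _ ->]].
    by exists (Ordinal lti).
  by rewrite mem_cycle.
rewrite /psi big_imset /= => [|i j _ _ /eqP].
  by apply: eq_bigr => i _; rewrite orderXgcd gcdnC.
by rewrite eq_expg_mod_order !modn_small // => /eqP/val_inj.
Qed.

Lemma psi_cyclicE (gT : finGroupType) (G : {group gT}) :
  cyclic G -> psi G = psi_cyclic #|G|.
Proof. by case/cyclicP=> x ->; apply: psi_cycle. Qed.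

Lemma gcdnM_coprime i a b :
  coprime a b -> gcdn i (a * b) = (gcdn i a * gcdn i b)%N.
Proof.
move=> co; apply/eqP; rewrite eqn_dvd; apply/andP; split.
  rewrite muln_gcdl !muln_gcdr !dvdn_gcd dvdn_gcdr.
  by rewrite [(_ %| a * i)%N]dvdn_mull ?[(_ %| i * _)%N]dvdn_mulr ?dvdn_gcdl.
rewrite dvdn_gcd dvdn_mul ?dvdn_gcdr // andbT Gauss_dvd ?dvdn_gcdl //.
by rewrite (coprime_dvdl (dvdn_gcdr i a)) ?(coprime_dvdr (dvdn_gcdr i b)).
Qed.

(** Chinese remainder theorem: [i] corresponds to its residues modulo [a] and [b], and the orders of
    these residues multiply. *)
Lemma psi_cyclicM a b : 0 < a -> 0 < b -> coprime a b ->
  psi_cyclic (a * b) = (psi_cyclic a * psi_cyclic b)%N.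
Proof.
move=> a0 b0 co; rewrite /psi_cyclic big_distrlr pair_big /=.
pose f (i : 'I_(a * b)) := (Ordinal (ltn_pmod i a0), Ordinal (ltn_pmod i b0)).
have fI : injective f.
  move=> i j [/eqP eqa /eqP eqb]; apply/val_inj/eqP.
  by have := chinese_remainder co i j; rewrite eqa eqb !modn_small => // ->.
have fB : bijective f by apply: inj_card_bij; rewrite // card_prod !card_ord.
rewrite (reindex f) /=; last by apply: onW_bij.
apply: eq_bigr => i _; rewrite !gcdn_modl.
by rewrite (gcdnM_coprime _ co) divnMA -divn_mulAC ?muln_divA ?dvdn_gcdr.
Qed.

Lemma psi_cyclic_gt0 n : 0 < n -> 0 < psi_cyclic n.
Proof.
case: n => // n _; rewrite /psi_cyclic big_ord_recl gcd0n divnn.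
by rewrite addn_gt0.
Qed.

(** The multiples of [p] form the subgroup of order [p ^ k]; every other element is a generator. *)
Lemma psi_cyclic_expS p k : prime p ->
  psi_cyclic (p ^ k.+1) = (psi_cyclic (p ^ k) + (p ^ k.+1 - p ^ k) * p ^ k.+1)%N.
Proof.
move=> p_pr; have p0 := prime_gt0 p_pr.
rewrite /psi_cyclic (bigID (fun i : 'I__ => p %| i)) /=; congr (_ + _)%N.
  have lti (i : 'I_(p ^ k)) : p * i < p ^ k.+1 by rewrite expnS ltn_pmul2l.
  pose f i := Ordinal (lti i).
  have -> : \sum_(i < p ^ k.+1 | p %| i) p ^ k.+1 %/ gcdn i (p ^ k.+1) =
            \sum_(i in [set f j | j in 'I_(p ^ k)]) p ^ k.+1 %/ gcdn i (p ^ k.+1).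
    apply: eq_bigl => i; apply/idP/imsetP => [/dvdnP[j ij] | [j _ ->]]; last first.
      by rewrite dvdn_mulr.
    have ltj : j < p ^ k.
      by rewrite -(ltn_pmul2l p0) -expnS mulnC -ij.
    by exists (Ordinal ltj) => //; apply/val_inj; rewrite /= mulnC.
  rewrite big_imset => [|i j _ _ [] /eqP] /=; last first.
    by rewrite eqn_pmul2l // => /eqP/val_inj.
  by apply: eq_bigr => i _; rewrite expnS -muln_gcdr divnMl.
rewrite (eq_bigr (fun=> p ^ k.+1)%N) => [|i ndv]; last first.
  suff -> : gcdn i (p ^ k.+1) = 1%N by rewrite divn1.
  by apply/eqP; rewrite -/(coprime _ _) coprimeXr // coprime_sym prime_coprime.
rewrite sum_nat_const; congr (_ * _)%N.
have -> : (p ^ k.+1 - p ^ k)%N = totient (p ^ k.+1).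
  by rewrite totient_pfactor // expnS -subn1 mulnBl mul1n.
rewrite totient_count_coprime big_mkord -sum1_card big_mkcond /=.
by apply: eq_bigr => i _; rewrite unfold_in /= coprime_pexpl ?prime_coprime //.
Qed.

Lemma big_sdprod (gT : finGroupType) (R H G : {group gT}) (F : gT -> nat) :
  R ><| H = G ->
  (\sum_(g in G) F g = \sum_(h in H) \sum_(y in R) F (h * y)%g)%N.
Proof.
case/sdprodP=> _ <- nRH tiRH.
have -> : R * H = [set (u.1 * u.2)%g | u in setX H R].
  rewrite -(normC nRH); apply/setP=> g; apply/mulsgP/imsetP.
    by case=> h y Hh Ry ->; exists (h, y); rewrite // inE Hh.
  by case=> [[h y] /setXP[Hh Ry] ->]; exists h y.
rewrite big_imset => [|[h1 y1] [h2 y2] /setXP[Hh1 Ry1] /setXP[Hh2 Ry2] /= e]; last first.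
  have e' : h2^-1 * h1 = y2 * y1^-1.
    by apply: (mulgI h2); rewrite mulKVg mulgA -e mulgK.
  have : h2^-1 * h1 \in R :&: H by rewrite inE {1}e' !(groupM, groupV).
  rewrite tiRH => /set1gP h21.
  have hh : h1 = h2 by apply: (mulgI h2^-1); rewrite h21 mulVg.
  by move: e; rewrite hh => /mulgI ->.
by rewrite pair_big; apply: eq_bigl => u; rewrite inE.
Qed.

(** As [<[y]>] is characteristic in the cyclic group [R], it is normalised by [h], so [(h * y) ^+
    #[h]] falls into [<[y]>]. *)
Lemma order_mul_cyclic_normal (gT : finGroupType) (R : {group gT}) (h y : gT) :
  cyclic R -> h \in 'N(R) -> y \in R -> #[h * y] %| #[h] * #[y].
Proof.
move=> cR nRh Ry.
have nyh : h \in 'N(<[y]>).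
  have chy : <[y]> \char R by rewrite sub_cyclic_char // cycle_subG.
  exact: subsetP (char_norm_trans chy (subxx _)) h nRh.
have nyy : y \in 'N(<[y]>) by rewrite (subsetP (normG _)) ?cycle_id.
have : (h * y) ^+ #[h] \in <[y]>.
  apply: coset_idr; first by rewrite groupX ?groupM.
  rewrite morphX ?groupM // mkerr ?ker_coset ?cycle_id //.
  by rewrite -morphX // expg_order morph1.
move/order_dvdG; rewrite /= -orderE => d; apply: dvdn_trans (dvdn_mul (dvdnn _) d).
by rewrite order_dvdn expgM expg_order.
Qed.

Lemma psi_sdprod_cyclic (gT : finGroupType) (R H G : {group gT}) :
  R ><| H = G -> cyclic R -> psi G <= psi R * psi H.
Proof.
move=> defG cR; have [_ _ nRH _] := sdprodP defG.
rewrite {1}/psi (big_sdprod _ defG) mulnC /psi big_distrlr /=.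
apply: leq_sum => h Hh; apply: leq_sum => y Ry.
by rewrite dvdn_leq ?muln_gt0 ?order_gt0 ?(order_mul_cyclic_normal cR) ?(subsetP nRH).
Qed.

Lemma psi_isog (gT rT : finGroupType) (G : {group gT}) (H : {group rT}) :
  G \isog H -> psi G = psi H.
Proof.
case/isogP=> f injf <-; rewrite /psi morphimEdom big_imset /=; last exact/injmP.
by apply: eq_bigr => x Gx; rewrite order_injm.
Qed.

Lemma psi_normal_cyclic_Hall (gT : finGroupType) (R G : {group gT}) :
    R <| G -> Hall G R -> cyclic R ->
  psi G <= psi_cyclic #|R| * psi (G / R).
Proof.
move=> nRG hallR cR; have /splitsP[H /complP[tiRH defG]] := SchurZassenhaus_split hallR nRG.
have sdG : R ><| H = G.
  by rewrite sdprodE //; move: (normal_norm nRG); rewrite -defG mulG_subG => /andP[].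
by rewrite -(psi_isog (sdprod_isog sdG)) -psi_cyclicE // psi_sdprod_cyclic.
Qed.

Lemma psi_cyclic_le n : psi_cyclic n <= n ^ 2.
Proof.
rewrite /psi_cyclic -mulnn -[X in _ <= X * _]card_ord -sum_nat_const.
by apply: leq_sum => i _; apply: leq_div.
Qed.

(** The exact value of the right side is [p ^ (2k + 1) + 1]; only the final 1 is dropped. *)
Lemma psi_cyclic_exp_ge p k : prime p ->
  (p * (p ^ k) ^ 2 <= p.+1 * psi_cyclic (p ^ k))%N.
Proof.
move=> p_pr; have p0 := prime_gt0 p_pr; elim: k => [|k IHk].
  by rewrite /psi_cyclic big_ord_recl big_ord0.
rewrite psi_cyclic_expS // mulnDr; move: IHk; rewrite (expnS p k).
move: (psi_cyclic (p ^ k)) (p ^ k)%N => u q; rewrite -[X in (_ - X)%N]mul1n -mulnBl subn1.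
case: p p0 {p_pr} => //= p _ IHk.
have -> : (p.+1 * (p.+1 * q) ^ 2 = p.+1 * q ^ 2 + p.+2 * (p * q * (p.+1 * q)))%N.
  by ring.
by rewrite leq_add2r.
Qed.

(** Cleared of denominators, this bounds [psi_cyclic n] below by [n ^ 2] times the product of all
    [r / (r + 1)]. The induction splits off the full power of the least prime divisor. *)
Lemma psi_cyclic_ge n : 0 < n ->
  (n ^ 2 * \prod_(p <- primes n) p <= psi_cyclic n * \prod_(p <- primes n) p.+1)%N.
Proof.
elim/ltn_ind: n => n IHn n_gt0.
have [n1 | n_gt1] := leqP n 1.
  have -> : n = 1%N by apply/eqP; rewrite eqn_leq n1.
  by rewrite !big_nil /psi_cyclic big_ord_recl big_ord0.
have p_pr := pdiv_prime n_gt1; set p := pdiv n in p_pr.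
have p_n : p \in primes n by rewrite mem_primes p_pr n_gt0 pdiv_dvd.
have n'_lt : n`_p^' < n.
  rewrite -[X in _ < X](partnC p n_gt0) -[X in X < _]mul1n ltn_pmul2r ?part_gt0 //.
  by rewrite p_part -{1}(expn0 p) ltn_exp2l ?prime_gt1 // logn_gt0.
have /IHn := n'_lt; rewrite part_gt0 => /(_ isT) IH.
have pp : perm_eq (primes n) (p :: primes n`_p^').
  apply: uniq_perm; rewrite ?primes_uniq //= ?primes_uniq ?andbT.
    by rewrite primes_part mem_filter /= inE /= inE eqxx.
  move=> q; rewrite inE primes_part mem_filter /= !inE.
  by case: eqVneq => [->|].
rewrite !(perm_big _ pp) /= !big_cons -{1 3}(partnC p n_gt0).
rewrite psi_cyclicM ?part_gt0 ?coprime_partC // p_part.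
have := leq_mul (psi_cyclic_exp_ge (logn p n) p_pr) IH.
apply: etrans; congr (_ <= _)%N; ring.
Qed.

(** In a noncyclic group of order [p ^ k.+1] all orders are at most [p ^ k]; the lower bound for the
    cyclic group then suffices because [p + 1 <= p ^ 2]. *)
Lemma psi_pgroup_le (p : nat) (gT : finGroupType) (G : {group gT}) :
  prime p -> p.-group G -> psi G <= psi_cyclic #|G|.
Proof.
move=> p_pr pG; have [cG | ncG] := boolP (cyclic G); first by rewrite psi_cyclicE.
have [[|k] cardG] := p_natP pG.
  by case/negP: ncG; rewrite (card1_trivg cardG) cyclic1.
have lo g : g \in G -> #[g] <= p ^ k.
  move=> Gg; have := order_dvdG Gg; rewrite cardG => /(dvdn_pfactor _ _ p_pr)[j lej oj].
  rewrite oj leq_exp2l ?prime_gt1 // -ltnS ltn_neqAle lej andbT.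
  apply: contraNneq ncG => jk; apply/cyclicP; exists g; apply/esym/eqP.
  by rewrite eqEcard cycle_subG Gg cardG -orderE oj jk /=.
have : psi G <= p ^ k.+1 * p ^ k.
  by rewrite -cardG -sum_nat_const; apply: leq_sum => g /lo.
have := psi_cyclic_exp_ge k.+1 p_pr; rewrite cardG (expnS p k).
have := prime_gt1 p_pr.
move: (psi G) (psi_cyclic (p * p ^ k)) (p ^ k)%N => u v q p_gt1 le_v le_u.
rewrite -(leq_pmul2l (ltn0Sn p)); apply: leq_trans le_v.
apply: leq_trans (leq_mul (leqnn _) le_u) _.
have -> : (p * (p * q) ^ 2 = p * p * (p * q * q))%N by ring.
by rewrite leq_mul2r; apply/orP; right; nia.
Qed.

(** * Cyclic subgroups of small index *)

Lemma card_Syl_dvd_index p (gT : finGroupType) (P H G : {group gT}) :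
  p.-Sylow(G) P -> H \subset 'N_G(P) -> #|'Syl_p(G)| %| #|G : H|.
Proof.
move=> sylP sHN; rewrite (card_Syl sylP).
by rewrite -(Lagrange_index _ sHN) ?subsetIl // dvdn_mulr.
Qed.

Lemma normal_Sylow_card_Syl p (gT : finGroupType) (P G : {group gT}) :
  p.-Sylow(G) P -> #|'Syl_p(G)| = 1%N -> P <| G.
Proof.
move=> sylP /eqP/normal_sylowP[Q sylQ nQG].
by rewrite /normal (uniq_normal_Hall sylQ nQG (Hall_max sylP)).
Qed.

Lemma card_meet_conj (gT : finGroupType) (A G : {group gT}) g :
  A \subset G -> g \in G -> #|A : A :&: A :^ g| <= #|G : A|.
Proof.
move=> sAG Gg; have := mul_cardG A (A :^ g)%G; rewrite /= cardJg => e.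
have le_G : #|A * A :^ g| <= #|G|.
  by rewrite subset_leq_card // mul_subG // conj_subG.
have k_gt0 : 0 < #|A :&: A :^ g| := cardG_gt0 _.
rewrite -(leq_pmul2l k_gt0) -(leq_pmul2l (cardG_gt0 A)) (Lagrange (subsetIl _ _)) e.
by rewrite mulnCA (Lagrange sAG) mulnC leq_mul2l le_G orbT.
Qed.

(** If [A] is not normal, it is maximal, so [A] and some conjugate [A :^ g] generate [G]. Both are
    abelian, hence their intersection [K] is central, and [A / K] has order at most [q]. *)
Lemma cyclic_prime_index_supersolvable (gT : finGroupType) (A G : {group gT}) :
  A \subset G -> cyclic A -> prime #|G : A| -> supersolvable G.
Proof.
set q := #|G : A| => sAG cA q_pr.
have [nAG | ] := boolP (A <| G).
  apply: (supersolvable_quotient nAG cA); apply/cyclic_supersolvable/prime_cyclic.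
  by rewrite card_quotient ?normal_norm.
rewrite /normal sAG => /subsetPn[g Gg nNg].
pose K := (A :&: A :^ g)%G.
have sAgG : A :^ g \subset G by rewrite conj_subG.
have defG : A <*> A :^ g = G.
  have /maximal_eqP[_ /(_ (A <*> A :^ g)%G)] : maximal_eq A G.
    by rewrite /maximal_eq p_index_maximal ?orbT.
  rewrite joing_subl join_subG sAG sAgG => -[] // JA.
  case/negP: nNg; rewrite inE -{2}JA; exact: joing_subr.
have cK : K \subset 'Z(G).
  rewrite subsetI subIset ?sAG //= centsC -defG join_subG.
  rewrite !sub_abelian_cent ?subsetIl ?subsetIr ?abelianJ ?cyclic_abelian //.
have nKG := sub_center_normal cK.
apply: (supersolvable_quotient nKG); first by rewrite (cyclicS _ cA) ?subsetIl.
have := card_meet_conj sAG Gg; rewrite -/q -[A :&: _]/(gval K).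
have nKA : A \subset 'N(K) by apply: subset_trans (normal_norm nKG).
rewrite -card_quotient // => le_q.
have sAb : A / K \subset G / K by rewrite quotientS.
have cardGb : #|G / K| = (#|A / K| * q)%N.
  rewrite -(Lagrange sAb) index_quotient_eq ?(normal_norm nKG) //.
  by rewrite subIset // subsetIl orbT.
have cAb : cyclic (A / K) by rewrite quotient_cyclic.
have [eq_q | ne_q] := eqVneq #|A / K| q.
  apply: (@pgroup_supersolvable q).
  by rewrite /pgroup /= cardGb eq_q pnatM !pnat_id.
have {ne_q}lt_q : #|A / K| < q by rewrite ltn_neqAle ne_q.
have [Q sylQ] := Sylow_exists q (G / K)%G.
have coAq : coprime #|A / K| q by rewrite coprime_sym prime_coprime // gtnNdvd.
have cardQ : #|Q| = q.
  rewrite (card_Hall sylQ) cardGb partnM ?(prime_gt0 q_pr) // (part_pnat_id (pnat_id q_pr)).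
  by rewrite part_p'nat ?mul1n // p'natE // gtnNdvd.
have iQ : #|G / K : Q| = #|A / K|.
  by rewrite -divgS ?(pHall_sub sylQ) // cardQ cardGb mulnK ?prime_gt0.
(* The number of Sylow [q]-subgroups is 1 modulo [q] and divides [#|A / K| < q]. *)
have nQ : Q <| (G / K)%G.
  apply: (normal_Sylow_card_Syl sylQ); rewrite -(card_Syl_mod (G / K)%G q_pr).
  rewrite modn_small //; apply: leq_ltn_trans lt_q; rewrite -iQ.
  by rewrite dvdn_leq ?indexg_gt0 ?(card_Syl_dvd_index sylQ) ?subsetI ?(pHall_sub sylQ) ?normG.
apply: (supersolvable_quotient nQ); first by rewrite prime_cyclic ?cardQ.
apply: cyclic_supersolvable.
have defGb : (A / K) * Q = G / K.
  apply/eqP; rewrite eqEcard mul_subG ?(pHall_sub sylQ) //= coprime_cardMg ?cardQ //.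
  by rewrite cardGb.
by rewrite /= -defGb quotientMidr !quotient_cyclic.
Qed.

(** * Burnside's normal complement theorem by transfer *)

Lemma abelian_Sylow_fusion (p : nat) (gT : finGroupType) (R G : {group gT}) x u :
    p.-Sylow(G) R -> 'N_G(R) \subset 'C(R) -> x \in R -> u \in G ->
  x ^ u \in R -> x ^ u = x.
Proof.
move=> sylR NC Rx Gu Rxu.
have sRG := pHall_sub sylR.
have abR : abelian R by apply: subset_trans NC; rewrite subsetI sRG normG.
have sC (S : {group gT}) : p.-Sylow(G) S -> abelian S -> x ^ u \in S -> p.-Sylow('C_G[x ^ u]) S.
  move=> sylS abS Sxu; apply: (pHall_subl _ _ sylS); last exact: subsetIl.
  by rewrite subsetI (pHall_sub sylS) sub_cent1 (subsetP abS).
(* [R] and [R :^ u] are both Sylow in the centraliser of [x ^ u], so some [v] there conjugates one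
   to the other. Then [u * v^-1] normalises [R], hence centralises [x]. *)
have sylRu : p.-Sylow('C_G[x ^ u]) (R :^ u)%G.
  by apply: sC; rewrite ?pHallJ ?abelianJ ?memJ_conjg.
have [v /setIP[Gv /cent1P Cv] /= defR] := Sylow_trans (sC R sylR abR Rxu) sylRu.
have Nuv : u * v^-1 \in 'N_G(R).
  by rewrite inE groupM ?groupV //= inE conjsgM defR conjsgK.
have := subsetP NC _ Nuv => /centP/(_ x Rx) cxuv.
have e : x ^ (u * v^-1) = x by rewrite conjgE -cxuv mulKg.
by rewrite -[RHS]e conjgM [RHS]conjgE invgK mulgA Cv mulgK.
Qed.

(** The transfer into [R] acts on [R] as the power map with exponent [#|G : R|], which is prime to
    [#|R|]. Its kernel therefore meets [R] trivially, and a comparison of orders makes the kernel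
    the complement. *)
Lemma normal_complement_exists (p : nat) (gT : finGroupType) (R G : {group gT}) :
    p.-Sylow(G) R -> 'N_G(R) \subset 'C(R) ->
  exists2 K : {group gT}, K <| G & p^'.-Hall(G) K.
Proof.
move=> sylR NC; have sRG := pHall_sub sylR.
have abR : abelian R by apply: subset_trans NC; rewrite subsetI sRG normG.
(* The transfer takes values in an abelian image of [R]; the identity morphism makes that image [R]
   itself. *)
have abA : abelian (idm R @* R) by rewrite morphim_idm.
pose V := transfer_morphism G abA.
have VR g : g \in R -> V g = 1 -> g = 1.
  move=> Rg; have Gg := subsetP sRG g Rg.
  have Ag : g \in idm R @* R by rewrite morphim_idm.
  pose X := transversal (rcosets R G :* <[g]>) G.
  have trX : is_transversal X (rcosets R G :* <[g]>) G.
    exact/transversalP/rcosets_cycle_partition.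
  (* Each factor is a conjugate, lying in [R], of a power of [g], so by fusion control it equals
     that power; the exponents add up to [#|G : R|]. *)
  rewrite /V /= (transfer_cycle_expansion sRG abA Gg trX).
  rewrite (eq_bigr (fun x => FiniteModule.fmod abA g *+ #|<[g]> : R :* x|)%R) => [|x Xx].
    rewrite GRing.sumrMnr (sum_index_rcosets_cycle sRG Gg trX) -FiniteModule.fmodX //.
    move/(congr1 FiniteModule.fmval); rewrite FiniteModule.fmodK ?groupX // => gm.
    have : #[g] %| gcdn #|R| #|G : R|.
      by rewrite dvdn_gcd order_dvdG // order_dvdn; apply/eqP.
    have /eqP-> : coprime #|R| #|G : R|.
      by have /pHall_Hall/andP[] := sylR.
    by rewrite dvdn1 order_eq1 => /eqP.
  have Gx : x \in G by apply: (subsetP (transversal_sub trX)).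
  rewrite /restrm /= (abelian_Sylow_fusion sylR NC) -?FiniteModule.fmodX ?groupV ?groupX //.
  have := mulg_exp_card_rcosets R g x.
  by rewrite mem_rcoset conjgE invgK mulgA.
have sylK : 'ker V :&: R = 1.
  apply/trivgP/subsetP=> g /setIP[/morphpreP[Gg /set1gP Vg] Rg].
  by rewrite inE (VR g).
exists ('ker V)%G; first exact: ker_normal.
rewrite pHallE subsetIl /=.
have le1 : #|'ker V| * #|R| <= #|G|.
  by rewrite -TI_cardMg // subset_leq_card // mul_subG ?subsetIl.
have le2 : #|G| <= #|'ker V| * #|R|.
  rewrite -(Lagrange (subsetIl _ _ : 'ker V \subset G)) leq_mul2l; apply/orP; right.
  have := card_morphim V G; rewrite setIid => <-.
  rewrite -(card_imset _ (@FiniteModule.fmod_inj _ _ abA)).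
  apply/subset_leq_card/subsetP=> _ /imsetP[u _ ->].
  have sR : idm R @* R \subset R by rewrite morphim_idm.
  exact: subsetP sR _ (FiniteModule.fmodP u).
have e : (#|'ker V| * #|R|)%N = #|G| by apply/eqP; rewrite eqn_leq le1.
rewrite -(eqn_pmul2r (cardG_gt0 R)) e (card_Hall sylR) mulnC partnC //.
Qed.

(* The witness is [#|R Q : R Q :&: A|], the number of Sylow [r]-subgroups of
   [R Q], where [R] is a Sylow [r]-subgroup of [A] and [Q] is a Sylow
   [q]-subgroup of a normal [r]-complement that is normalised by [R]. *)
Lemma self_normalizing_cyclic_index (r q : nat) (gT : finGroupType)
    (R A G : {group gT}) :
    prime r -> q != r -> cyclic A -> A \subset G ->
    r.-Sylow(G) R -> R \subset A -> 'N_G(R) \subset A ->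
  exists i, [/\ i = 1 %[mod r], q.-nat i, (#|G : A|)`_q %| i & i <= #|G : A|].
Proof.
move=> r_pr qr cA sAG sylR sRA sNA; have sRG := pHall_sub sylR.
have abA := cyclic_abelian cA.
have NC : 'N_G(R) \subset 'C(R) by rewrite (subset_trans sNA) // sub_abelian_cent.
have [K nKG hallK] := normal_complement_exists sylR NC.
have [Q sylQ] := Sylow_exists q K.
have sQK := pHall_sub sylQ.
have sylQG : q.-Sylow(G) Q.
  rewrite pHallE (subset_trans sQK (normal_sub nKG)) (card_Hall sylQ) (card_Hall hallK).
  by rewrite partn_part //= => p; rewrite !inE => /eqP->.
(* Since [K] has order prime to [r], the Frattini factorisation puts a full Sylow [r]-subgroup of
   [G] into ['N_G(Q)]; conjugation turns it into [R]. *)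
have defG := Frattini_arg nKG sylQ.
have [R1 sylR1] := Sylow_exists r 'N_G(Q).
have sylR1G : r.-Sylow(G) R1.
  rewrite pHallE (subset_trans (pHall_sub sylR1)) ?subsetIl //= (card_Hall sylR1).
  rewrite eqn_dvd partn_dvd ?cardG_gt0 ?cardSg ?subsetIl //=.
  have dG : #|G| %| #|K| * #|'N_G(Q)| by rewrite mul_cardG defG dvdn_mulr.
  have := partn_dvd r _ dG; rewrite muln_gt0 !cardG_gt0 => /(_ isT).
  by rewrite partnM // (part_p'nat (pHall_pgroup hallK)) mul1n.
have [x Gx /= defR] := Sylow_trans sylR1G sylR.
have nQR : R \subset 'N(Q :^ x).
  by rewrite defR normJ conjSg (subset_trans (pHall_sub sylR1)) ?subsetIr.
pose H := (Q :^ x <*> R)%G.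
have cardH : #|H| = (#|Q| * #|R|)%N.
  rewrite /= norm_joinEr // TI_cardMg ?cardJg //.
  rewrite coprime_TIg // cardJg (pnat_coprime (pHall_pgroup sylQ)) //.
  by rewrite (pi_pnat (pHall_pgroup sylR)) // inE /= inE eq_sym.
have sHG : H \subset G by rewrite join_subG conj_subG ?(pHall_sub sylQG).
have sRH : R \subset H by apply: joing_subr.
have sylRH : r.-Sylow(H) R by apply: pHall_subl sylR.
have NHR : 'N_H(R) = H :&: A.
  apply/eqP; rewrite eqEsubset !subsetI !subsetIl /=; apply/andP; split.
    by rewrite (subset_trans _ sNA) // setSI.
  by rewrite subIset // orbC (subset_trans _ (cent_sub _)) // sub_abelian_cent.
have sRHA : R \subset H :&: A by rewrite subsetI sRH.
have iq : q.-nat #|H : H :&: A|.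
  have := Lagrange_index (subsetIl H A) sRHA => /(congr1 (pnat q)).
  rewrite pnatM => /esym; rewrite -divgS // cardH mulnK //.
  by rewrite -/(pgroup q Q) (pHall_pgroup sylQ) => /esym/andP[].
exists #|H : H :&: A|; split=> //.
- by rewrite -NHR -(card_Syl sylRH) (card_Syl_mod _ r_pr) modn_small ?prime_gt1.
(* After multiplication by the [q]-part of [#|A|] the left side is the [q]-part of [#|G|], which is
   also that of [#|H|]; the [q]-part of [#|H :&: A|] divides that of [#|A|]. *)
- rewrite -(part_pnat_id iq) -(@dvdn_pmul2l (#|A|`_q)%N) ?part_gt0 //.
  rewrite -partnM // (Lagrange sAG) -(card_Hall sylQG).
  have -> : #|Q| = (#|H|`_q)%N.
    rewrite cardH partnM // (part_pnat_id (pHall_pgroup sylQ)).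
    rewrite part_p'nat ?muln1 // (pi_pnat (pHall_pgroup sylR)) //.
    by rewrite inE /= inE eq_sym.
  rewrite -(Lagrange (subsetIl H A)) partnM // dvdn_mul // partn_dvd //.
  by rewrite cardSg ?subsetIr.
by rewrite indexgI subset_leq_card // imsetS.
Qed.

(** * The possible indices *)

Section PossibleIndices.

Local Open Scope nat_scope.

(** This is monotonicity of the product of the factors [1 + 1 / r] under inclusion, without
    fractions. *)
Lemma leq_prod_succ_sub (s t : seq nat) :
    uniq s -> uniq t -> {subset s <= t} ->
  \prod_(r <- s) r.+1 * \prod_(r <- t) r <= \prod_(r <- s) r * \prod_(r <- t) r.+1.
Proof.
move=> us ut st.
have pt : perm_eq t (s ++ [seq r <- t | r \notin s]).
  apply: uniq_perm => //.
    rewrite cat_uniq us filter_uniq // andbT -all_predC; apply/allP => r /=.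
    by rewrite mem_filter => /andP[].
  move=> r; rewrite mem_cat mem_filter.
  by case: (boolP (r \in s)) => // /st ->.
rewrite !(perm_big _ pt) /= !big_cat /= mulnCA leq_mul2l; apply/orP; right.
by rewrite leq_mul2l leq_prod ?orbT // => r _.
Qed.

(** The product of [1 + 1 / r] over all odd [r] from 3 to [2k + 1] is at most the square root of
    [2k + 1]. This growth is slow enough to bound the index. *)
Lemma sqr_prod_succ_odd k :
  (\prod_(j < k) (j.*2.+4)) ^ 2 <= k.*2.+1 * (\prod_(j < k) (j.*2.+3)) ^ 2.
Proof.
elim: k => [|k IHk]; first by rewrite !big_ord0.
rewrite !big_ord_recr /= !expnMn.
have -> : (k.+1).*2.+1 = k.*2.+3 by lia.
move: IHk; move: (\prod_(j < k) _) (\prod_(j < k) _) => a b IHk.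
have le1 : k.*2.+1 * k.*2.+4 ^ 2 <= k.*2.+3 * k.*2.+3 ^ 2 by rewrite -!mul2n; nia.
apply: (@leq_trans (k.*2.+1 * a ^ 2 * k.*2.+4 ^ 2)); first by rewrite leq_mul2r IHk orbT.
by rewrite mulnAC mulnCA [X in _ <= X]mulnC leq_mul2r le1 orbT.
Qed.

(* Possible primes [r]: if [r] does not divide [m], the number [d] of Sylow
   [r]-subgroups must satisfy these conditions. *)
Definition admissible (m r : nat) :=
  (r %| m) || has (fun d => (1 < d) && (d %| m) && (d == 1 %[mod r])) (iota 0 m.+1).

(** For [m > 0] the cutoff at [m] loses nothing: an admissible [r] divides [m] or some [d - 1] with
    [1 < d <= m]. *)
Definition admissible_primes m :=
  [seq r <- iota 0 m.+1 | [&& prime r, odd r & admissible m r]].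

(* Binary numbers: the products in [index_check] are too large for unary [nat]. *)
Definition prodN (s : seq nat) : N := foldr (fun r acc => N.mul (N.of_nat r) acc) 1%num s.

Lemma prodNE s : N.to_nat (prodN s) = \prod_(r <- s) r.
Proof.
elim: s => [|r s IHs]; first by rewrite big_nil.
by rewrite big_cons -IHs /= N2Nat.inj_mul Nat2N.id.
Qed.

(** The first disjunct says that the bound on [m] fails even for the largest possible set of primes;
    the others list the indices that survive. *)
Definition index_check m :=
  let t := admissible_primes m in
  [|| N.leb (N.mul 3647 (prodN (map succn t))) (N.mul 271 (N.mul (N.of_nat m) (prodN t))),
      m == 1, prime m, t == [:: 3]
    | ((m == 15) || (m == 21)) && (t == [:: 3; 5; 7])].

Lemma index_check_all : all (fun k => index_check k.*2.+1) (iota 0 92).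
Proof. by vm_compute. Qed.

Lemma index_cases (n m : nat) :
    odd n -> odd m -> {in primes n, forall r, admissible m r} ->
    271 * m * \prod_(r <- primes n) r < 3647 * \prod_(r <- primes n) r.+1 ->
  [\/ m = 1, prime m, {subset primes n <= [:: 3]}
    | {subset primes n <= [:: 3; 5; 7]} /\ (m = 15 \/ m = 21 /\ 5 \in primes n)].
Proof.
move=> n_odd m_odd adm lt_mn.
have m_gt0 : 0 < m by case: m m_odd {adm lt_mn}.
have n_gt0 : 0 < n by case: n n_odd {adm lt_mn}.
have uP := primes_uniq n.
have odd_r r : r \in primes n -> [/\ prime r, odd r & r <= m].
  move=> nr; have := nr; rewrite mem_primes => /and3P[r_pr _ r_n].
  split=> //; first exact: dvdn_odd r_n n_odd.
  case/orP: (adm r nr) => [/dvdn_leq-> //|/hasP[d _ /andP[/andP[d_gt1 d_m]]]].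
  rewrite eqn_mod_dvd ?(ltnW d_gt1) // => /dvdn_leq.
  rewrite subn_gt0 => /(_ d_gt1) le_r; apply: leq_trans le_r _.
  by rewrite (leq_trans (leq_subr _ _)) // dvdn_leq.
have s_adm : {subset primes n <= admissible_primes m}.
  move=> r nr; have [r_pr r_odd le_rm] := odd_r r nr.
  by rewrite mem_filter r_pr r_odd adm // mem_iota add0n ltnS.
have [k km] : exists k, m = k.*2.+1.
  by exists m./2; rewrite -[LHS]odd_double_half m_odd.
have bound t : uniq t -> {subset primes n <= t} -> all (leq 1) t ->
    271 * m * \prod_(r <- t) r < 3647 * \prod_(r <- t) r.+1.
  move=> ut st /allP t_gt0; have := leq_prod_succ_sub uP ut st.
  have a_gt0 : 0 < \prod_(r <- primes n) r.
    by rewrite big_seq_cond prodn_cond_gt0 // => r; rewrite andbT => /odd_r[/prime_gt0].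
  have A_gt0 : 0 < \prod_(r <- t) r.
    by rewrite big_seq_cond prodn_cond_gt0 // => r; rewrite andbT => /t_gt0.
  move=> le_st; rewrite -(ltn_pmul2l a_gt0) mulnCA [X in _ < X]mulnCA.
  rewrite mulnA; apply: (@leq_trans (3647 * \prod_(r <- primes n) r.+1 * \prod_(r <- t) r)).
    by rewrite ltn_pmul2r.
  by rewrite -mulnA leq_mul2l le_st.
(* With all odd numbers from 3 to [m] in place of the primes, the bound gives
   [m < (3647 / 271) ^ 2], which is about 181.1. *)
have lt_k : k < 92.
  pose t := [seq j.*2.+3 | j <- iota 0 k].
  have ut : uniq t by rewrite map_inj_uniq ?iota_uniq // => i j; lia.
  have st : {subset primes n <= t}.
    move=> r /odd_r[/prime_gt1 r_gt1 r_odd le_rm]; apply/mapP.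
    exists (r - 3)./2; rewrite ?mem_iota; lia.
  have := bound t ut st; rewrite !big_map all_map => /(_ (introT allP (fun _ _ => isT))).
  have e (f : nat -> nat) : \prod_(j <- iota 0 k) f j = \prod_(j < k) f j.
    by rewrite -(big_mkord xpredT) /index_iota subn0.
  rewrite !{}e; have := sqr_prod_succ_odd k; rewrite -km.
  have : 0 < \prod_(j < k) j.*2.+3 by rewrite prodn_gt0.
  move: (\prod_(j < k) j.*2.+3) (\prod_(j < k) j.*2.+4) => A B A_gt0 H3 H4.
  have H5 : (271 * m * A) ^ 2 < (3647 * B) ^ 2 by rewrite ltn_exp2r.
  have H6 : 271 ^ 2 * m < 3647 ^ 2.
    have mA_gt0 : 0 < m * A ^ 2 by rewrite muln_gt0 m_gt0 expn_gt0 A_gt0.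
    rewrite -(ltn_pmul2r mA_gt0); move: H5; rewrite !expnMn => H5.
    apply: (@leq_trans (3647 ^ 2 * B ^ 2)); last by rewrite leq_mul2l H3 orbT.
    by move: H5; rewrite -!mulnA [m * (m * _)]mulnA mulnn.
  lia.
have := allP index_check_all k; rewrite mem_iota add0n lt_k => /(_ isT).
rewrite -km /index_check; set t := admissible_primes m in s_adm *.
have ut : uniq t by rewrite filter_uniq ?iota_uniq.
case/or4P => [le | /eqP-> | m_pr | ].
- have /(bound t ut s_adm) : all (leq 1) t.
    by apply/allP => r; rewrite mem_filter => /andP[/andP[/prime_gt0]].
  have /N.leb_le := le; rewrite -mulnA -!prodNE.
  have -> : \prod_(r <- t) r.+1 = N.to_nat (prodN (map succn t)) by rewrite prodNE big_map.
  by move: (prodN t) (prodN (map succn t)) => a b; lia.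
- by constructor 1.
- by constructor 2.
case/orP => [/eqP t3 | /andP[m_eq /eqP t357]]; first by constructor 3; rewrite -t3.
constructor 4; rewrite t357 in s_adm; split=> //; case/orP: m_eq => /eqP m_eq; [left | right] => //.
(* Without 5 the bound would read [m < 3647 / 271 * (4 / 3) * (8 / 7)], about 20.5, against
   [m = 21]. *)
split=> //; apply: contraT => n5.
have : {subset primes n <= [:: 3; 7]}.
  move=> r nr; have := s_adm r nr; rewrite !inE; case: eqP nr => //= _ nr; case: eqP nr => //= -> nr.
  by rewrite nr in n5.
by move/bound => /(_ isT isT); rewrite m_eq !big_cons !big_nil.
Qed.

End PossibleIndices.

(** * Index 15 *)

(* A subgroup of a cyclic group is determined by its order, so [E :&: E :^ g],
   which is normalised by ['N(E)], is also normalised by [g]; hence it is normal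
   as soon as ['N_G(E)] and [g] generate [G]. *)
Lemma cyclic_meet_conj_normal (gT : finGroupType) (E G : {group gT}) :
    cyclic E -> E \subset G -> maximal_eq 'N_G(E) G ->
  exists2 g, g \in G & E :&: E :^ g <| G /\ (E <| G \/ E :^ g != E).
Proof.
move=> cE sEG maxM; have [nEG | nEG] := boolP (E <| G).
  by exists 1; rewrite // conjsg1 setIid; split; [|left].
move: nEG; rewrite /normal sEG => /subsetPn[g Gg nEg].
exists g => //; split; last by right; move: nEg; rewrite inE; apply: contra => /eqP->.
have defG : 'N_G(E) <*> <[g]> = G.
  have /maximal_eqP[_ /(_ ('N_G(E) <*> <[g]>)%G)] := maxM.
  rewrite joing_subl join_subG subsetIl cycle_subG Gg => -[] // JN.
  case/negP: nEg; suff /setIP[] : g \in 'N_G(E) by [].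
  by rewrite -JN -cycle_subG joing_subr.
rewrite /normal subIset ?sEG //= -{1}defG join_subG; apply/andP; split.
  have chF : E :&: E :^ g \char E by rewrite sub_cyclic_char ?subsetIl.
  by rewrite (char_norm_trans chF) ?subsetIr.
have cEg : cyclic (E :^ g) by rewrite cyclicJ.
have sFg : (E :&: E :^ g) :^ g \subset E :^ g by rewrite conjSg subsetIl.
have := eq_subG_cyclic cEg sFg (subsetIr E (E :^ g)).
by rewrite /= cardJg eqxx => /eqP eF; rewrite cycle_subG inE eF.
Qed.

(** ['N_G(E)] contains the abelian group [A], so its index divides [p * q]; it contains [P], in
    which [E] has index [p], so its index is prime to [p]. *)
Lemma normaliser_cyclic_Sylow (p q : nat) (gT : finGroupType) (A E G : {group gT}) :
    prime p -> prime q -> p != q -> cyclic A -> A \subset G -> #|G : A| = (p * q)%N ->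
    p.-Sylow(A) E ->
  maximal_eq 'N_G(E) G /\ exists2 P : {group gT}, p.-Sylow(G) P & E \subset P /\ #|P : E| = p.
Proof.
move=> p_pr q_pr pq cA sAG iA sylE; have sEA := pHall_sub sylE.
have [P sylP sEP] := Sylow_superset (subset_trans sEA sAG) (pHall_pgroup sylE).
have iE : #|P : E| = p.
  rewrite -divgS // (card_Hall sylP) (card_Hall sylE) -(Lagrange sAG) iA.
  rewrite !partnM ?muln_gt0 ?cardG_gt0 ?prime_gt0 // (part_pnat_id (pnat_id p_pr)).
  by rewrite [(q`_p)%N]part_p'nat ?muln1 ?mulKn ?part_gt0 // p'natE // dvdn_prime2.
split; last by exists P.
have sAN : A \subset 'N_G(E).
  by rewrite subsetI sAG (subset_trans _ (cent_sub _)) // sub_abelian_cent ?cyclic_abelian.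
have sPN : P \subset 'N_G(E).
  rewrite subsetI (pHall_sub sylP) normal_norm //.
  by apply: p_maximal_normal (pHall_pgroup sylP) _; rewrite p_index_maximal ?iE.
have sNG : 'N_G(E) \subset G := subsetIl _ _.
have : #|G : 'N_G(E)| %| q.
  have := Lagrange_index sNG sAN; rewrite iA => e.
  have p'N : ~~ (p %| #|G : 'N_G(E)|).
    have /and3P[_ _] := sylP; rewrite -(Lagrange_index sNG sPN) pnatM => /andP[].
    by rewrite p'natE.
  rewrite -(@Gauss_dvdr _ p); first by rewrite -e dvdn_mulr.
  by rewrite coprime_sym prime_coprime.
have [_ q_dv] := primeP q_pr => /q_dv/orP[/eqP i1 | /eqP iq].
  by rewrite /maximal_eq (index1g sNG i1) eqxx.
by rewrite /maximal_eq p_index_maximal ?iq ?orbT.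
Qed.

(** [P] acts on [F] through a [q]-subgroup of [Aut F], whose order is [totient #|F|]. *)
Lemma coprime_totient_cent (q : nat) (gT : finGroupType) (F P : {group gT}) :
    q.-group P -> cyclic F -> P \subset 'N(F) -> q^'.-nat (totient #|F|) ->
  P \subset 'C(F).
Proof.
move=> qP cF nFP q'F.
rewrite -ker_conj_aut ker_trivg_morphim nFP /=.
have sPA : conj_aut F @* P \subset Aut F := Aut_conj_aut F P.
have qI : q.-nat #|conj_aut F @* P| := morphim_pgroup _ qP.
have q'I : q^'.-nat #|conj_aut F @* P|.
  by apply: pnat_dvd q'F; rewrite -card_Aut_cyclic // cardSg.
by rewrite (card1_trivg (pnat_1 qI q'I)).
Qed.

Lemma card_Sylow35 (gT : finGroupType) (T P G : {group gT}) :
    {subset primes #|G| <= [:: 3; 5]} -> 3.-Sylow(G) T -> 5.-Sylow(G) P ->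
  #|G| = (#|P| * #|T|)%N.
Proof.
move=> pi35 sylT sylP; rewrite (card_Hall sylT) (card_Hall sylP) mulnC.
rewrite -{1}(partnC 3 (cardG_gt0 G)); congr (_ * _)%N; apply: eq_in_partn => p.
by move/pi35; rewrite !inE => /orP[] /eqP->.
Qed.

(** A normal 3-subgroup [F] of index at most 45 in a Sylow 3-subgroup is centralised by [P]. The
    number of Sylow 5-subgroups then divides [#|T : F|]. *)
Lemma normal_Sylow5_of_index15 (gT : finGroupType) (A P G : {group gT}) :
    cyclic A -> A \subset G -> #|G : A| = 15 ->
    {subset primes #|G| <= [:: 3; 5]} -> 5.-Sylow(G) P -> P <| G.
Proof.
move=> cA sAG iA pi35 sylP.
have [E sylE] := Sylow_exists 3 A; have sEA := pHall_sub sylE.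
have cE := cyclicS sEA cA.
have [] := normaliser_cyclic_Sylow (_ : prime 3) (_ : prime 5) _ cA sAG iA sylE => //.
case/(cyclic_meet_conj_normal cE (subset_trans sEA sAG)) => g Gg [].
pose F := (E :&: E :^ g)%G; rewrite -[E :&: _]/(gval F) => nFG _ [T sylT [sET iE]].
have sFE : F \subset E by apply: subsetIl.
have tF : 3.-group F := pgroupS sFE (pHall_pgroup sylE).
have le_EF : #|E : F| <= 15.
  have eF : gval F = E :&: (A :&: A :^ g).
    apply/eqP; rewrite eqEsubset setIA (setIidPl sEA) setIS ?conjSg //=.
    rewrite subsetI subsetIl /=.
    have sylEg : 3.-Sylow(A :^ g) (E :^ g)%G by rewrite pHallJ2.
    rewrite (sub_normal_Hall sylEg) ?subsetIr ?(pgroupS _ (pHall_pgroup sylE)) ?subsetIl //.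
    rewrite -sub_abelian_normal ?cyclic_abelian ?cyclicJ //= conjSg //.
  rewrite eF indexgI -iA; apply: leq_trans (card_meet_conj sAG Gg).
  by rewrite subset_leq_card // imsetS.
have sFT := subset_trans sFE sET.
have le_TF : #|T : F| <= 45.
  by rewrite -(Lagrange_index sET sFE) iE; apply: (leq_mul (leqnn 3) le_EF).
have nFP : P \subset 'N(F) := subset_trans (pHall_sub sylP) (normal_norm nFG).
have cFP : P \subset 'C(F).
  apply: (coprime_totient_cent (pHall_pgroup sylP)) => //; first exact: cyclicS cE.
  have [k ->] := p_natP tF; case: k => [|k]; first by [].
  by rewrite totient_pfactor //= p'natE // Euclid_dvdM // Euclid_dvdX.
have sNP : P <*> F \subset 'N_G(P).
  rewrite subsetI join_subG (pHall_sub sylP) (normal_sub nFG) /=.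
  rewrite join_subG normG (subset_trans _ (cent_sub P)) //.
  by rewrite centsC.
apply: (normal_Sylow_card_Syl sylP).
have := card_Syl_dvd_index sylP sNP.
have -> : #|G : P <*> F| = #|T : F|.
  rewrite -!divgS //; last by apply: subset_trans sNP (subsetIl _ _).
  rewrite (card_Sylow35 pi35 sylT sylP) /= norm_joinEl // TI_cardMg ?divnMl //.
  by rewrite coprime_TIg // (pnat_coprime (pHall_pgroup sylP)) // (pi_pnat tF).
have tT : 3.-nat #|T : F| := pnat_dvd (dvdn_indexg T F) (pHall_pgroup sylT).
have := card_Syl_mod G (isT : prime 5).
move: #|_| => n n5 n_dv; have := pnat_dvd n_dv tT; have := dvdn_leq (indexg_gt0 _ _) n_dv.
move=> /leq_trans/(_ le_TF) le_n /p_natP[k nk]; move: n5 le_n; rewrite {n n_dv}nk.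
(* Among 1, 3, 9 and 27 only 1 is 1 modulo 5; the next such power of 3 is 81, beyond 45. *)
case: k => [|[|[|[|k]]]] // _ le_45.
by have := leq_trans (_ : 3 ^ 4 <= 3 ^ k.+4) le_45; rewrite leq_exp2l // => /(_ isT).
Qed.

(* [x |-> x ^+ p] is an endomorphism of [P] since [P] has class at most 2 and [p]
   is odd; [M] is the product of [L] with its kernel. *)
Lemma modular_pgroup_normal (p : nat) (gT : finGroupType) (D L P G : {group gT}) :
    prime p -> odd p -> P <| G -> L <| G -> L \subset D -> D \subset P -> cyclic D ->
    P \subset 'C(L) -> p.-group P -> #|P : L| = (p ^ 2)%N -> #|D : L| = p -> L :!=: 1 ->
    {in P, forall x, x ^+ p \in L} ->
  exists M : {group gT}, [/\ M <| G, L \subset M, M \subset P, #|M : L| = p & #|P : M| = p].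
Proof.
move=> p_pr p_odd nPG nLG sLD sDP cD cLP pP iPL iDL ntL Pp.
have sLP := subset_trans sLD sDP.
have nLP : P \subset 'N(L) := subset_trans (normal_sub nPG) (normal_norm nLG).
have cardPL : #|P / L| = (p ^ 2)%N by rewrite card_quotient.
have abPL : abelian (P / L) := card_p2group_abelian p_pr cardPL.
have RL : [~: P, P] \subset L by rewrite -quotient_cents2.
have cL x y : x \in P -> y \in L -> commute x y.
  by move=> Px Ly; apply: (centsP cLP).
have Rxy x y : x \in P -> y \in P -> [~ x, y] \in L.
  by move=> Px Py; apply: (subsetP RL); rewrite mem_commg.
have fM : {in P &, {morph (fun y => y ^+ p) : x y / x * y}}.
  move=> y x Py Px /=; rewrite expMg_Rmul; try by apply: cL => //; apply: Rxy.
  suff -> : [~ x, y] ^+ 'C(p, 2) = 1 by rewrite mulg1.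
  have Rp : [~ x, y] ^+ p = 1.
    rewrite -commXg; last by apply: cL => //; apply: Rxy.
    by apply/eqP/commgP/commute_sym/cL; rewrite ?Pp.
  have p2 : 2 < p by rewrite odd_prime_gt2.
  have /dvdnP[k ->] : p %| 'C(p, 2) by rewrite prime_dvd_bin.
  by rewrite mulnC expgM Rp expg1n.
pose f := Morphism fM.
have kerE y : (y \in 'ker f) = (y \in P) && (y ^+ p == 1).
  by rewrite inE /= inE /= inE.
have sKP : 'ker f \subset P := subsetIl _ _.
have nKG : 'ker f <| G.
  rewrite /normal (subset_trans sKP (normal_sub nPG)); apply/subsetP=> x Gx.
  rewrite inE; apply/subsetP=> _ /imsetP[y Ky ->]; move: Ky; rewrite !kerE.
  case/andP=> Py /eqP yp; rewrite memJ_norm ?(subsetP (normal_norm nPG)) // Py.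
  by rewrite -conjXg yp conj1g eqxx.
(* The image of [f] lies in [L], which has index [p ^ 2] in [P]. *)
have cardK : p ^ 2 <= #|'ker f|.
  rewrite -(leq_pmul2l (cardG_gt0 L)) -iPL Lagrange //.
  rewrite -(Lagrange sKP) mulnC leq_mul2r; apply/orP; right.
  have := card_morphim f P; rewrite setIid => <-; apply: subset_leq_card.
  by apply/subsetP=> _ /morphimP[y _ Py ->]; apply: Pp.
pose M := (L <*> 'ker f)%G.
have nKL : 'ker f \subset 'N(L) := subset_trans sKP nLP.
have sLM : L \subset M := joing_subl _ _.
have sMP : M \subset P by rewrite join_subG sLP.
(* Otherwise a generator [d] of [D] has the same [p]-th power as some [l] in [L], so its order
   divides [#|L|], although it is [p * #|L|]. *)
have iMP : #|P : M| != 1%N.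
  apply/eqP=> /(index1g sMP) defP; have [d defD] := cyclicP cD.
  have Pd : d \in P by rewrite (subsetP sDP) // defD cycle_id.
  have := Pd; rewrite -{1}defP /= norm_joinEr // => /mulsgP[l w Ll Kw dlw].
  have Pl := subsetP sLP l Ll; have Pw := subsetP sKP w Kw.
  have dp : d ^+ p = l ^+ p.
    have := fM l w Pl Pw; rewrite /= -dlw => ->.
    by move: Kw; rewrite kerE => /andP[_ /eqP->]; rewrite mulg1.
  have /dvdnP[k cardL] : p %| #|L|.
    by have [] := pgroup_pdiv (pgroupS sLP pP) ntL.
  have cardD : #[d] = (p * #|L|)%N by rewrite orderE -defD -(Lagrange sLD) iDL mulnC.
  have k_gt0 : 0 < k by move: (cardG_gt0 L); rewrite cardL muln_gt0 => /andP[].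
  have : #[d] %| p * k.
    rewrite order_dvdn expgM dp -expgM mulnC -cardL; apply/eqP.
    exact: expg_cardG.
  rewrite cardD dvdn_pmul2l ?prime_gt0 // cardL => /(dvdn_leq k_gt0).
  by rewrite leqNgt ltn_Pmulr ?prime_gt1.
(* Otherwise the kernel is cyclic of exponent dividing [p], too small for [cardK]. *)
have iLM : #|M : L| != 1%N.
  apply/eqP=> /(index1g sLM) defL.
  have sKL : 'ker f \subset L by rewrite defL joing_subr.
  have [w defK] := cyclicP (cyclicS (subset_trans sKL sLD) cD).
  have : w \in 'ker f by rewrite defK cycle_id.
  rewrite kerE -order_dvdn => /andP[_ /(dvdn_leq (prime_gt0 p_pr))].
  rewrite orderE -defK => /(leq_trans cardK); rewrite leqNgt.
  by rewrite -{1}(expn1 p) ltn_exp2l ?prime_gt1.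
have e := Lagrange_index sMP sLM; rewrite iPL in e.
have : #|M : L| %| p ^ 2 by rewrite -e dvdn_mull.
case/(dvdn_pfactor _ _ p_pr) => -[|[|[|//]]] _ iM; rewrite iM in e iLM.
- by [].
- exists M; split=> //; first exact: normalY.
  apply/eqP; rewrite -(eqn_pmul2r (prime_gt0 p_pr)); apply/eqP; exact: e.
- move/eqP: e; rewrite -{2}[(p ^ 2)%N]mul1n eqn_pmul2r ?expn_gt0 ?prime_gt0 //.
  by rewrite (negPf iMP).
Qed.

Lemma supersolvable_over_prime_index (gT : finGroupType) (N M G : {group gT}) :
    N <| G -> N \subset M -> M <| G -> prime #|M : N| -> supersolvable_over M G ->
  supersolvable_over N G.
Proof.
move=> nNG sNM nMG iM; apply: supersolvable_over_cons => //.
rewrite prime_cyclic // card_quotient //.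
exact: subset_trans (normal_sub nMG) (normal_norm nNG).
Qed.

Lemma supersolvable_over_cyclic (gT : finGroupType) (N G : {group gT}) :
  N <| G -> cyclic N -> supersolvable_over N G -> supersolvable G.
Proof.
move=> nNG cN ss; apply/supersolvable_overP/(supersolvable_over_cons _ nNG _ ss).
  exact: sub1G.
exact: quotient_cyclic.
Qed.

(** Unless [D] is normal, [L] has index 5 in [D], [P] is the product of [D] and [D :^ g], and [L] is
    central in [P]. A nontrivial [L] leads to a series through [L], [M], [P]; a trivial one is the
    exceptional case. *)
Lemma index15_structure (gT : finGroupType) (A P G : {group gT}) :
    cyclic A -> A \subset G -> #|G : A| = 15 ->
    {subset primes #|G| <= [:: 3; 5]} -> 5.-Sylow(G) P ->
  supersolvable G \/
  exists D : {group gT}, exists2 g, g \in G &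
    [/\ #|D| = 5, A \subset 'C(D), #|P| = 25, D * D :^ g = P & ~~ (D <| G)].
Proof.
move=> cA sAG iA pi35 sylP; have nPG := normal_Sylow5_of_index15 cA sAG iA pi35 sylP.
have sPG := normal_sub nPG; have pP := pHall_pgroup sylP.
have [T sylT] := Sylow_exists 3 G.
have ssP : supersolvable_over P G.
  apply: (@pgroup_quotient_supersolvable_over 3) => //.
  rewrite /pgroup card_quotient ?normal_norm // -divgS //.
  rewrite (card_Sylow35 pi35 sylT sylP) mulKn //; exact: pHall_pgroup sylT.
have [D sylD] := Sylow_exists 5 A; have sDA := pHall_sub sylD.
have cD := cyclicS sDA cA; have sDG := subset_trans sDA sAG.
have [] := normaliser_cyclic_Sylow (_ : prime 5) (_ : prime 3) _ cA sAG iA sylD => //.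
case/(cyclic_meet_conj_normal cD sDG) => g Gg [].
pose L := (D :&: D :^ g)%G; rewrite -[D :&: _]/(gval L) => nLG nD [P1 sylP1 [sDP iPD]].
have eP : P1 :=: P by apply: (uniq_normal_Hall sylP nPG (Hall_max sylP1)).
rewrite eP in sDP iPD.
have [nDG | nnDG] := boolP (D <| G).
  left; apply: (supersolvable_over_cyclic nDG cD).
  by apply: (supersolvable_over_prime_index nDG sDP nPG) => //; rewrite iPD.
have {nD} nDg : D :^ g != D by case: nD nnDG => // ->.
have sDgP : D :^ g \subset P by rewrite -(normsP (normal_norm nPG) g Gg) conjSg.
have sLD : L \subset D := subsetIl _ _.
have cardDL : (#|D| * #|D| = #|(D * D :^ g)%g| * #|L|)%N.
  by rewrite -{2}(cardJg D g) (mul_cardG D (D :^ g)%G).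
have leDDg : #|D * D :^ g| <= #|P| by rewrite subset_leq_card // mul_subG.
have iDL : #|D : L| = 5.
  have : 5.-nat #|D : L| := pnat_dvd (dvdn_indexg D L) (pHall_pgroup sylD).
  case/p_natP => -[|[|k]] iDL; last 2 first.
  - by rewrite iDL.
  - have : #|D : L| <= 5.
      rewrite -(leq_pmul2l (cardG_gt0 L)) Lagrange // -(leq_pmul2l (cardG_gt0 D)).
      rewrite cardDL mulnCA mulnC leq_mul2l -iPD Lagrange // leDDg orbT //.
    by rewrite iDL -{2}(expn1 5) leq_exp2l.
  case/eqP: nDg; apply/eqP; rewrite eq_sym eqEcard cardJg leqnn andbT.
  by rewrite -{1}(index1g sLD iDL) subsetIr.
have DDg : D * D :^ g = P.
  apply/eqP; rewrite eqEcard mul_subG //=.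
  have cardD : #|D| = (5 * #|L|)%N by rewrite mulnC -iDL Lagrange.
  by rewrite -(leq_pmul2r (cardG_gt0 L)) -cardDL -(Lagrange sDP) iPD -mulnA -cardD.
have iPL : #|P : L| = (5 ^ 2)%N by rewrite -(Lagrange_index sDP sLD) iDL iPD.
have cLP : P \subset 'C(L).
  rewrite -DDg mul_subG // sub_abelian_cent ?cyclic_abelian ?cyclicJ ?subsetIr //.
have [L1 | ntL] := eqVneq (L : {set gT}) 1.
  right; exists D, g => //; split=> //.
  - by rewrite -(Lagrange sLD) iDL L1 cards1.
  - by rewrite sub_abelian_cent ?cyclic_abelian.
  - by rewrite -(Lagrange (subset_trans sLD sDP)) iPL L1 cards1.
left.
have Pp : {in P, forall x, x ^+ 5 \in L}.
  have nLP : P \subset 'N(L) by rewrite (subset_trans cLP) ?cent_sub.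
  have abPL : abelian (P / L).
    by rewrite (@card_p2group_abelian _ 5) //= card_quotient.
  have Q5 (B : {group gT}) : L \subset B -> B \subset P -> #|B| = #|D| ->
      {in B, forall y, coset L y ^+ 5 = 1}.
    move=> sLB sBP cardB y By.
    have <- : #|B / L| = 5.
      rewrite card_quotient ?(subset_trans sBP) // -divgS // cardB.
      by rewrite -(Lagrange sLD) iDL mulKn.
    by rewrite expg_cardG ?mem_quotient.
  move=> x; rewrite -{1}DDg => /mulsgP[d e Dd De ->].
  have Pd := subsetP sDP d Dd; have Pe := subsetP sDgP e De.
  apply: coset_idr; first by rewrite groupX ?groupM // (subsetP nLP).
  rewrite morphX ?groupM ?(subsetP nLP) //= morphM ?(subsetP nLP) //=.
  rewrite expgMn; last by apply: (centsP abPL); rewrite mem_quotient.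
  by rewrite (Q5 D) // (Q5 (D :^ g)%G) ?subsetIr ?cardJg ?mulg1.
have [] := @modular_pgroup_normal 5 _ D L P G => // M [nMG sLM sMP iML iPM].
apply: (supersolvable_over_cyclic nLG (cyclicS sLD cD)).
apply: (supersolvable_over_prime_index nLG sLM nMG); first by rewrite iML.
by apply: (supersolvable_over_prime_index nMG sMP nPG); first by rewrite iPM.
Qed.

Lemma index15_supersolvable_or_psi_le (gT : finGroupType) (A G : {group gT}) :
    cyclic A -> A \subset G -> #|G : A| = 15 ->
    {subset primes #|G| <= [:: 3; 5]} ->
  supersolvable G \/ 3647 * psi G <= 271 * psi_cyclic #|G|.
Proof.
move=> cA sAG iA pi35; have [P sylP] := Sylow_exists 5 G.
have nPG := normal_Sylow5_of_index15 cA sAG iA pi35 sylP.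
have [|[D [g Gg [cardD cDA cardP DDg nnDG]]]] := index15_structure cA sAG iA pi35 sylP.
  by left.
have sPG := normal_sub nPG; have pP := pHall_pgroup sylP.
have abP : abelian P by rewrite (@card_p2group_abelian _ 5).
have sDP : D \subset P by rewrite -DDg mulG_subl.
pose C := 'C_G(D)%G.
(* The index of [C] divides 15 because of [A] and is prime to 5 because of [P]; index 1 would make
   [D] normal. *)
have sCG : C \subset G := subsetIl _ _.
have sPC : P \subset C by rewrite subsetI sPG sub_abelian_cent.
have sAC : A \subset C by rewrite subsetI sAG.
have iC : #|G : C| = 3.
  have d3 : #|G : C| %| 3.
    have d15 : #|G : C| %| 5 * 3 by rewrite -[(5 * 3)%N]iA -(Lagrange_index sCG sAC) dvdn_mulr.
    rewrite -(@Gauss_dvdr _ 5) // coprime_sym prime_coprime //.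
    have /and3P[_ _] := sylP; rewrite -(Lagrange_index sCG sPC) pnatM => /andP[].
    by rewrite p'natE.
  have [_ /(_ _ d3)/orP[/eqP/(index1g sCG) CG|/eqP//]] := primeP (isT : prime 3).
  case/negP: nnDG; rewrite /normal -{1 2}CG (subset_trans sDP sPC) /=.
  by rewrite subIset // cent_sub orbT.
have [T sylT] := Sylow_exists 3 G; have sTG := pHall_sub sylT.
have cardG := card_Sylow35 pi35 sylT sylP.
have tiPT : P :&: T = 1.
  by rewrite coprime_TIg // (pnat_coprime pP) // (pi_pnat (pHall_pgroup sylT)).
have defG : P ><| T = G.
  rewrite sdprodE // ?(subset_trans sTG (normal_norm nPG)) //.
  by apply/eqP; rewrite eqEcard mul_subG //= TI_cardMg // cardG.
have [_ mulPT nPT _] := sdprodP defG.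
pose T0 := (T :&: C)%G.
have sT0T : T0 \subset T := subsetIl _ _.
have mulPT0 : P * T0 = C by rewrite group_modl // mulPT (setIidPr sCG).
have iT0 : #|T : T0| = 3.
  have cardC : #|C| = (#|P| * #|T0|)%N.
    by rewrite -mulPT0 TI_cardMg // /= setIA tiPT (setIidPl (sub1G _)).
  by rewrite -iC -!divgS // cardC cardG divnMl ?cardG_gt0.
have nCG : C <| G.
  rewrite /normal sCG -mulPT mul_subG //.
    by rewrite (subset_trans sPC) ?normG.
  have nT0T : T0 <| T.
    apply: p_maximal_normal (pHall_pgroup sylT) _.
    by rewrite p_index_maximal ?iT0.
  by rewrite -mulPT0 normsM // ?normal_norm.
(* Being normal, [C] centralises [D :^ g] as well as [D]. *)
have cCP : C \subset 'C(P).
  rewrite -DDg centM subsetI subsetIr /= centJ -(normsP (normal_norm nCG) g Gg) conjSg.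
  exact: subsetIr.
have expP y : y \in P -> #[y] %| 5.
  rewrite -DDg => /mulsgP[d e Dd De ->]; rewrite order_dvdn expgMn.
    by rewrite -cardD expg_cardG // -(cardJg D g) expg_cardG ?mulg1.
  apply: (centsP abP); first exact: subsetP sDP _ _.
  by rewrite -DDg; apply: (subsetP (mulG_subr _ _)).
have ssP : supersolvable_over P G.
  apply: (@pgroup_quotient_supersolvable_over 3) => //.
  rewrite /pgroup card_quotient ?normal_norm // -divgS //.
  by rewrite cardG mulKn //; exact: pHall_pgroup sylT.
have [/exists_inP[h /setDP[Gh nCh] /exists_inP[y Py /andP[nty chy]]] | noFix] :=
    boolP [exists h in G :\: C, [exists y in P, (y != 1) && (h \in 'C[y])]].
  left.
  have Gy := subsetP sPG y Py.
  have sPCC : P \subset 'C(C) by rewrite centsC.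
  have cyG : 'C_G[y] = G.
    have /maximal_eqP[_ /(_ 'C_G[y]%G)] : maximal_eq C G.
      by rewrite /maximal_eq p_index_maximal ?iC ?orbT.
    rewrite subsetIl subsetI sCG sub_cent1 (subsetP sPCC) //.
    case=> // CC; case/negP: nCh; by rewrite -CC inE Gh.
  have nyG : <[y]> <| G.
    apply: sub_center_normal; rewrite cycle_subG inE Gy /= -sub_cent1.
    by rewrite -{1}cyG subsetIr.
  have sYP : <[y]> \subset P by rewrite cycle_subG.
  have oy : #|<[y]>| = 5.
    have [_ /(_ _ (expP y Py))/orP[|/eqP//]] := primeP (isT : prime 5).
    by rewrite order_eq1 (negPf nty).
  apply: (supersolvable_over_cyclic nyG (cycle_cyclic y)).
  apply: (supersolvable_over_prime_index nyG sYP nPG) => //.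
  by rewrite -divgS // cardP oy.
right.
(* [(t * y) ^+ #[t]] lies in [P] and commutes with [t * y], which is outside [C]; by [noFix] it is
   trivial. *)
have orderC t y : t \in T -> y \in P -> t \notin C -> #[t * y] <= #[t].
  move=> Tt Py nCt; have Gt := subsetP sTG t Tt; have Gy := subsetP sPG y Py.
  have nCty : t * y \notin C by rewrite groupMr // (subsetP sPC).
  have Nt : t \in 'N(P) := subsetP nPT t Tt.
  have Ny : y \in 'N(P) := subsetP (normG P) y Py.
  apply: dvdn_leq => //; rewrite order_dvdn; apply: contraR noFix => nty.
  apply/exists_inP; exists (t * y); first by rewrite inE nCty groupM.
  apply/exists_inP; exists ((t * y) ^+ #[t]).
    apply: coset_idr; first by rewrite groupX ?groupM.
    rewrite morphX ?groupM // mkerr ?ker_coset //.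
    by rewrite -morphX // expg_order morph1.
  by rewrite nty; apply/cent1P; rewrite /commute -expgS -expgSr.
have orderC0 t y : y \in P -> t \in C -> #[t * y] <= #[t] * #[y].
  move=> Py Ct; have cty : commute t y by apply: (centsP cCP).
  apply: dvdn_leq; rewrite ?muln_gt0 ?order_gt0 // order_dvdn expgMn //.
  by rewrite expgM expg_order expg1n mul1g mulnC expgM expg_order expg1n.
have psiP : psi P <= 121.
  rewrite /psi (big_setD1 1) //= order1 -[121%N]/(1 + 24 * 5)%N leq_add2l.
  have <- : #|P :\ 1| = 24 by apply/eqP; rewrite -(eqn_add2l 1) -[1%N in X in X == _]/(true : nat) -(group1 P) -cardsD1 cardP.
  by rewrite -sum_nat_const; apply: leq_sum => y /setD1P[_ /expP/dvdn_leq->].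
(* The part over [T0] gives at most [121 = 96 + 25] times [psi T0]; the 25 joins the rest of [T]. *)
have le_psi : psi G <= 96 * psi T0 + 25 * psi T.
  rewrite /psi (big_sdprod _ defG) [X in _ <= _ + 25 * X](big_setID C) /=.
  rewrite (big_setID C) /= mulnDr addnA leq_add //.
    rewrite -mulnDl mulnC big_distrl /=; apply: leq_sum => t /setIP[_ Ct].
    apply: leq_trans (_ : #[t] * psi P <= _); last by rewrite leq_mul2l psiP orbT.
    by rewrite big_distrr; apply: leq_sum => y Py; apply: orderC0.
  rewrite big_distrr /=; apply: leq_sum => t /setDP[Tt nCt].
  by rewrite -cardP -sum_nat_const; apply: leq_sum => y Py; apply: orderC.
have tT := pHall_pgroup sylT.
have le_T := psi_pgroup_le (isT : prime 3) tT.
have le_T0 := psi_pgroup_le (isT : prime 3) (pgroupS sT0T tT).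
have [k cardT0] := p_natP (pgroupS sT0T tT).
have cardT : #|T| = (3 ^ k.+1)%N by rewrite -(Lagrange sT0T) iT0 cardT0 expnSr.
rewrite cardG cardP cardT psi_cyclicM ?expn_gt0 // ?coprimeXr //.
have -> : psi_cyclic 25 = 521.
  by rewrite /psi_cyclic !big_ord_recr big_ord0.
have := psi_cyclic_expS k (isT : prime 3); have := psi_cyclic_le (3 ^ k).
rewrite cardT in le_T; rewrite cardT0 in le_T0.
move: le_psi le_T le_T0; move: (psi G) (psi T) (psi T0) => a b c.
rewrite (expnS 3 k); set q := (3 ^ k)%N; set v := psi_cyclic (3 * q)%N.
set u := psi_cyclic q => le_a le_b le_c le_u ev.
(* Since [3647 = 7 * 521], the claim reduces to [7 * a <= 271 * v], and
   [7 * (96 * u + 25 * v) <= (96 + 175) * v]. *)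
have le_7u : (7 * u <= v)%N.
  have -> : v = (u + 6 * q ^ 2)%N by rewrite ev -[X in (3 * q - X)%N]mul1n -mulnBl subn1 /=; ring.
  by rewrite -[(7 * u)%N]/(u + 6 * u)%N leq_add2l leq_mul2l le_u orbT.
clearbody v u; have le_7a : (7 * a <= 271 * v)%N by clear -le_a le_b le_c le_7u; lia.
by rewrite -[3647%N]/(521 * 7)%N -mulnA [X in _ <= X]mulnCA leq_mul2l le_7a orbT.
Qed.

(** * The induction on the group order *)

Lemma Sylow_in_cyclic (r : nat) (gT : finGroupType) (A G : {group gT}) :
    prime r -> cyclic A -> A \subset G -> ~~ (r %| #|G : A|) ->
  exists R : {group gT},
    [/\ r.-Sylow(G) R, R \subset A & A \subset 'N_G(R)].
Proof.
move=> r_pr cA sAG ndv; have [R sylR] := Sylow_exists r A; exists R.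
have sRA := pHall_sub sylR; split=> //.
  rewrite pHallE (subset_trans sRA) //= (card_Hall sylR) -(Lagrange sAG).
  by rewrite partnM // [(#|G : A|`_r)%N]part_p'nat ?muln1 // p'natE.
by rewrite subsetI sAG (subset_trans _ (cent_sub _)) // sub_abelian_cent ?cyclic_abelian.
Qed.

Lemma exists_order_ge_mean (gT : finGroupType) (G : {group gT}) :
  exists2 x, x \in G & psi G <= #|G| * #[x].
Proof.
exists [arg max_(x > 1 in G) #[x]]; case: arg_maxnP => //= x Gx xmax.
by rewrite -sum_nat_const; apply: leq_sum.
Qed.

Lemma normal_cyclic_Hall_descent (gT : finGroupType) (R G : {group gT}) c d :
    R <| G -> Hall G R -> cyclic R ->
    c * psi_cyclic #|G| < d * psi G ->
  c * psi_cyclic #|G / R| < d * psi (G / R).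
Proof.
move=> nRG hallR cR; have /andP[sRG coR] := hallR.
rewrite -(Lagrange sRG) psi_cyclicM // -(card_quotient (normal_norm nRG)).
have psiR : 0 < psi_cyclic #|R| by rewrite psi_cyclic_gt0.
have le := psi_normal_cyclic_Hall nRG hallR cR => lt.
rewrite -(ltn_pmul2l psiR) mulnCA; apply: leq_trans lt _.
by rewrite mulnCA leq_mul2l le orbT.
Qed.

(** In use, [o] is the largest element order, [m] the index, [u] and [v] are the sums for the cyclic
    group and for [G], and [a] and [b] are the products of all [r] and all [r + 1]. *)
Lemma index_prod_bound n o m u v a b c d :
    n = (o * m)%N -> 0 < n -> 0 < b -> c * u < d * v -> v <= n * o ->
    n ^ 2 * a <= u * b ->
  c * m * a < d * b.
Proof.
move=> nE n_gt0 b_gt0 lt_uv le_v le_ab.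
have m_gt0 : 0 < m by move: n_gt0; rewrite nE muln_gt0 => /andP[].
have n2_gt0 : 0 < n ^ 2 by rewrite expn_gt0 n_gt0.
rewrite -(ltn_pmul2l n2_gt0).
have -> : (n ^ 2 * (c * m * a) = c * m * (n ^ 2 * a))%N by ring.
apply: (@leq_ltn_trans (c * m * (u * b))); first by rewrite leq_mul2l le_ab orbT.
have -> : (c * m * (u * b) = c * u * (m * b))%N by ring.
have -> : (n ^ 2 * (d * b) = d * (n * o) * (m * b))%N by rewrite nE; ring.
rewrite -(ltn_pmul2r (_ : 0 < m * b)) ?muln_gt0 ?m_gt0 // in lt_uv.
by apply: leq_trans lt_uv _; rewrite leq_mul2r leq_mul2l le_v !orbT.
Qed.

Theorem theorem1p1 (gT : finGroupType) (G : {group gT}) :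
  odd #|G| ->
  (271 * psi_cyclic #|G| < 3647 * psi G)%N ->
  supersolvable G.
Proof.
have [n] := ubnP #|G|; elim: n gT G => // n IHn gT G le_n odd_G lt_psi.
have [/existsP[R /and4P[nRG cR sylR ntR]] | /existsPn noR] :=
    boolP [exists R : {group gT}, [&& R <| G, cyclic R, Sylow G R & R :!=: 1]].
  have [r _ /pHall_Hall hallR] := SylowP _ _ sylR.
  apply: (supersolvable_quotient nRG cR); apply: IHn.
  - by rewrite ltnS in le_n; apply: leq_trans le_n; rewrite ltn_quotient ?normal_sub.
  - exact: dvdn_odd (dvdn_quotient _ _) odd_G.
  exact: normal_cyclic_Hall_descent lt_psi.
have nSyl r (R : {group gT}) : r \in primes #|G| -> r.-Sylow(G) R -> cyclic R ->
    #|'Syl_r(G)| != 1%N.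
  rewrite mem_primes => /and3P[r_pr _ r_dv] sylR cR; apply/negP=> /eqP n1.
  have /negP[] := noR R; rewrite (normal_Sylow_card_Syl sylR n1) cR (p_Sylow sylR).
  rewrite -cardG_gt1 (card_Hall sylR) p_part -(exp1n (logn r #|G|)) ltn_exp2r ?prime_gt1 //.
  by rewrite logn_gt0 mem_primes r_pr cardG_gt0.
have [x Gx le_psi] := exists_order_ge_mean G.
have sAG : <[x]> \subset G by rewrite cycle_subG.
have cA := cycle_cyclic x; set A := <[x]>%G; set m := #|G : A|.
have cardG : #|G| = (#[x] * m)%N by rewrite Lagrange.
have odd_m : odd m by apply: dvdn_odd (dvdn_indexg _ _) odd_G.
have SylA r : r \in primes #|G| -> ~~ (r %| m) ->
    exists R : {group gT}, [/\ r.-Sylow(G) R, R \subset A, A \subset 'N_G(R),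
      #|'Syl_r(G)| %| m & #|'Syl_r(G)| != 1%N].
  move=> r_G r_m; have r_pr : prime r by move: r_G; rewrite mem_primes => /andP[].
  have [R [sylR sRA sAN]] := Sylow_in_cyclic r_pr cA sAG r_m; exists R; split=> //.
    exact: card_Syl_dvd_index sylR sAN.
  exact: nSyl sylR (cyclicS sRA cA).
have adm : {in primes #|G|, forall r, admissible m r}.
  move=> r r_G; rewrite /admissible; have [//|r_m] := boolP (r %| m).
  have r_pr : prime r by move: r_G; rewrite mem_primes => /andP[].
  have [R [_ _ _ n_dv n1]] := SylA r r_G r_m; apply/hasP; exists #|'Syl_r(G)|.
    by rewrite mem_iota add0n ltnS; apply: (dvdn_leq _ n_dv); apply: indexg_gt0.
  rewrite n_dv (card_Syl_mod _ r_pr) (modn_small (prime_gt1 r_pr)) eqxx !andbT.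
  by rewrite ltn_neqAle eq_sym n1 (dvdn_gt0 (indexg_gt0 G A) n_dv).
have lt_m : 271 * m * \prod_(r <- primes #|G|) r < 3647 * \prod_(r <- primes #|G|) r.+1.
  have := psi_cyclic_ge (cardG_gt0 G).
  apply: (index_prod_bound cardG _ _ lt_psi le_psi) => //.
  by rewrite big_seq_cond prodn_cond_gt0.
(* If the Sylow count for [r] must be [m], then ['N_G(R)] has the order of [A] and equals it, so
   [self_normalizing_cyclic_index] applies. *)
have no r q : r \in primes #|G| -> prime q -> q != r -> ~~ (r %| m) ->
    (forall d, d %| m -> d != 1%N -> d %% r = 1%N -> d = m) ->
    exists i, [/\ i %% r = 1%N, q.-nat i, (q ^ logn q m)%N %| i & i <= m].
  move=> r_G q_pr qr r_m only_m; have [R [sylR sRA sAN n_dv n1]] := SylA r r_G r_m.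
  have r_pr : prime r by move: r_G; rewrite mem_primes => /andP[].
  have n_m := only_m _ n_dv n1 (card_Syl_mod _ r_pr).
  have sNA : 'N_G(R) \subset A.
    have <- : A :=: 'N_G(R); last by [].
    apply/eqP; rewrite eqEcard sAN /=.
    have := Lagrange (subsetIl G 'N(R)); rewrite -(card_Syl sylR) n_m cardG => /eqP.
    by rewrite (eqn_pmul2r (indexg_gt0 G A)) => /eqP->.
  have [i [i1 qi mi im]] := self_normalizing_cyclic_index r_pr qr cA sAG sylR sRA sNA.
  exists i; split=> //; last by rewrite -p_part.
  by rewrite i1 modn_small // prime_gt1.
case: (index_cases odd_G odd_m adm lt_m) => [m1 | m_pr | pi3 | [pi357 [m15 | [m21 G5]]]].
- by apply: cyclic_supersolvable; rewrite -(index1g sAG m1).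
- exact: cyclic_prime_index_supersolvable sAG cA m_pr.
- apply: (@pgroup_supersolvable 3); apply/pgroupP=> p p_pr p_G.
  by have := pi3 p; rewrite mem_primes p_pr cardG_gt0 !inE; apply.
- have pi35 : {subset primes #|G| <= [:: 3; 5]}.
    move=> r r_G; have := pi357 r r_G; rewrite !inE; case: (r =P 7) => [r7 _ | _]; last by rewrite orbF.
    rewrite r7 in r_G.
    (* The candidates for [i] are 3 and 9, neither of which is 1 modulo 7. *)
    have [||i [i7 i3 ii i_le]] := @no 7 3 r_G isT isT; rewrite ?m15 //.
      move=> d; rewrite dvdn_divisors // !inE.
      by case/or4P=> /eqP->.
    rewrite m15 in ii i_le.
    have /allP/(_ i) : all (fun i => ~~ [&& i %% 7 == 1%N, 3.-nat i & 3 %| i]) (iota 0 16).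
      by vm_compute.
    by rewrite mem_iota ltnS i_le i7 i3 ii => /(_ isT).
  have [// | le] := index15_supersolvable_or_psi_le cA sAG m15 pi35.
  by rewrite ltnNge le in lt_psi.
(* The only candidate for [i] is 7, which is 2 modulo 5. *)
have [||i [i5 i7 ii i_le]] := @no 5 7 G5 isT isT; rewrite ?m21 //.
  move=> d; rewrite dvdn_divisors // !inE.
  by case/or4P=> /eqP->.
rewrite m21 in ii i_le.
have /allP/(_ i) : all (fun i => ~~ [&& i %% 5 == 1%N, 7.-nat i & 7 %| i]) (iota 0 22).
  by vm_compute.
by rewrite mem_iota ltnS i_le i5 i7 ii => /(_ isT).
Qed.
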